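(* For every non-negative integer $L$, \[ \sum_{j=-L}^{L}\left(\frac{j+1}{3}\right)q^{j(j+1)}{2L\brack L-j}_q=\sum_{j=-L-1}^{L+1}\left(\frac{j+1}{3}\right)q^{j(j+1)}{2L+1\brack L-j}_q. \]
   Context: $(a;q)_n=\prod_{k=0}^{n-1}(1-aq^k)$. The $q$-binomial coefficient is ${m+n\brack m}_q=\frac{(q;q)_{m+n}}{(q;q)_m(q;q)_n}$ for $m,n\ge 0$ and $0$ otherwise. $\left(\frac{a}{3}\right)$ denotes the Jacobi symbol modulo 3: $0$ if $3\mid a$, $1$ if $a\equiv1\pmod 3$, $-1$ if $a\equiv 2\pmod 3$. *)

(* Defs.v *)
From HB Require Import structures.
From mathcomp Require Import all_boot all_order all_algebra.

Set Implicit Arguments.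
Unset Strict Implicit.
Unset Printing Implicit Defensive.

Import GRing.Theory Num.Theory.
Local Open Scope ring_scope.

(* (a;q)_n *)
Definition qpoch (F : fieldType) (a q : F) (n : nat) : F :=
  \prod_(k < n) (1 - a * q ^+ k).

(* [N, m]_q; the top index N = m + n is given and n is recovered as N - m. *)
Definition qbinom (F : fieldType) (q : F) (N m : int) : F :=
  if (0 <= m) && (0 <= N - m) then
    qpoch q q `|N|%N / (qpoch q q `|m|%N * qpoch q q `|N - m|%N)
  else 0.

(* The Jacobi symbol (a/3); [modz] takes values in {0, 1, 2}, also for a < 0. *)
Definition jacobi3 (a : int) : int :=
  if (a %% 3)%Z == 0 then 0 else if (a %% 3)%Z == 1 then 1 else -1.

(* The integers a, a + 1, ..., b, empty when b < a. *)
Definition zrange (a b : int) : seq int :=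
  if a <= b then [seq a + i%:Z | i <- iota 0 `|b - a|%N.+1] else [::].

(* Main.v *)
(** The q-Pascal rule splits the right-hand binomial [2L+1, L-j] as
    [2L, L-j] + q^(L+j+1) [2L, L-j-1].  The first part reproduces the left-hand
    side.  In the second, the exponent j(j+1) + L+j+1 equals L + (j+1)^2, so with
    k = j + 1 it becomes q^L times the sum of (k/3) q^(k^2) [2L, L-k], which
    vanishes because its terms are odd in k. *)
Require Import Defs.
From HB Require Import structures.
From mathcomp Require Import all_boot all_order all_algebra.
From mathcomp Require Import zify ring.

Set Implicit Arguments.
Unset Strict Implicit.
Unset Printing Implicit Defensive.

Import Order.TTheory GRing.Theory Num.Theory.
Local Open Scope ring_scope.

Lemma mem_zrange (a b j : int) : (j \in zrange a b) = (a <= j <= b).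
Proof.
rewrite /zrange; case: leP => [le_ab|lt_ba]; last by rewrite in_nil; lia.
apply/mapP/idP => [[i]|le_ajb]; first by rewrite mem_iota; lia.
by exists `|j - a|%N; [rewrite mem_iota|]; lia.
Qed.

Lemma zrange_uniq (a b : int) : uniq (zrange a b).
Proof.
rewrite /zrange; case: ifP => // _.
by rewrite map_inj_uniq ?iota_uniq // => i k; lia.
Qed.

Lemma zrange_shift (a b c : int) :
  zrange (a + c) (b + c) = [seq j + c | j <- zrange a b].
Proof.
rewrite /zrange lerD2r; case: ifP => // _.
rewrite opprD addrACA subrr addr0 -map_comp.
by apply: eq_map => i /=; rewrite addrAC.
Qed.

Section SumZrange.
Variable V : nmodType.
Implicit Types (a b c d : int) (f : int -> V).

Lemma sum_zrange_shift a b c f :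
  \sum_(j <- zrange a b) f (j + c) = \sum_(j <- zrange (a + c) (b + c)) f j.
Proof. by rewrite zrange_shift big_map. Qed.

Lemma sum_zrange_widen a b c d f :
    c <= a -> b <= d -> (forall j, ~~ (a <= j <= b) -> f j = 0) ->
  \sum_(j <- zrange c d) f j = \sum_(j <- zrange a b) f j.
Proof.
move=> le_ca le_bd f0; rewrite (bigID (fun j => a <= j <= b)) /=.
rewrite [X in _ + X]big1 // addr0 -big_filter; apply: perm_big.
apply: uniq_perm; rewrite ?filter_uniq ?zrange_uniq // => j.
by rewrite mem_filter !mem_zrange; lia.
Qed.

Lemma sum_zrange_symS (n : nat) f :
  \sum_(j <- zrange (- n.+1%:Z) n.+1%:Z) f j
  = f (- n.+1%:Z) + (f n.+1%:Z + \sum_(j <- zrange (- n%:Z) n%:Z) f j).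
Proof.
transitivity (\sum_(j <- [:: - n.+1%:Z, n.+1%:Z & zrange (- n%:Z) n%:Z]) f j);
  last by rewrite !big_cons.
apply: perm_big; apply: uniq_perm => [||j].
- exact: zrange_uniq.
- by rewrite /= zrange_uniq !inE !mem_zrange; lia.
- by rewrite mem_zrange !in_cons mem_zrange; lia.
Qed.

End SumZrange.

(* In characteristic 2, oddness alone does not force [f 0 = 0]. *)
Lemma sum_zrange_odd (V : zmodType) (f : int -> V) (n : nat) :
  f 0 = 0 -> (forall j, f (- j) = - f j) ->
  \sum_(j <- zrange (- n%:Z) n%:Z) f j = 0.
Proof.
move=> f0 fN; elim: n => [|n IHn].
  by rewrite oppr0 /zrange /= big_seq1 addr0.
by rewrite sum_zrange_symS IHn addr0 fN addNr.
Qed.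

Lemma jacobi3N (a : int) : jacobi3 (- a) = - jacobi3 a.
Proof. by rewrite /jacobi3; do 4?[case: ifP => //]; lia. Qed.

Lemma sum_jacobi3_even (R : pzRingType) (w : int -> R) (n : nat) :
  (forall k, w (- k) = w k) ->
  \sum_(k <- zrange (- n%:Z) n%:Z) (jacobi3 k)%:~R * w k = 0.
Proof.
move=> wN; apply: sum_zrange_odd => [|k]; first by rewrite mul0r.
by rewrite jacobi3N wN rmorphN mulNr.
Qed.

Section QBinomial.
Variables (F : fieldType) (q : F).
Implicit Types (N m : int) (n a b : nat).

Lemma qpoch0 (x : F) : qpoch x q 0 = 1.
Proof. exact: big_ord0. Qed.

Lemma qpochS (x : F) n : qpoch x q n.+1 = qpoch x q n * (1 - x * q ^+ n).
Proof. exact: big_ord_recr. Qed.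

Lemma qbinom_out N m : ~~ (0 <= m <= N) -> qbinom q N m = 0.
Proof. by rewrite /qbinom subr_ge0 => /negPf ->. Qed.

Lemma qbinom_sub N m : qbinom q N (N - m) = qbinom q N m.
Proof. by rewrite /qbinom subKr andbC [X in _ / X]mulrC. Qed.

Lemma qbinom_nat a b :
  qbinom q (a + b)%N%:Z a%:Z = qpoch q q (a + b) / (qpoch q q a * qpoch q q b).
Proof. by rewrite /qbinom PoszD addrAC subrr add0r. Qed.

Hypothesis expq_neq1 : forall k, (0 < k)%N -> q ^+ k <> 1.

Lemma subr_expq_neq0 n : 1 - q ^+ n.+1 != 0.
Proof. by rewrite subr_eq0 eq_sym; apply/eqP/expq_neq1. Qed.

Lemma qpoch_neq0 n : qpoch q q n != 0.
Proof. by apply/prodf_neq0 => k _; rewrite -exprS subr_expq_neq0. Qed.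

Lemma qbinom0 n : qbinom q n%:Z 0 = 1.
Proof. by rewrite -[n]add0n qbinom_nat qpoch0 mul1r divff ?qpoch_neq0. Qed.

Lemma qbinom_diag n : qbinom q n%:Z n%:Z = 1.
Proof. by rewrite -(qbinom0 n) -qbinom_sub subrr. Qed.

Lemma qbinom_pascal_nat a b :
  qbinom q (a.+1 + b.+1)%N%:Z a.+1%:Z
  = qbinom q (a.+1 + b)%N%:Z a.+1%:Z
    + q ^+ b.+1 * qbinom q (a + b.+1)%N%:Z a%:Z.
Proof.
rewrite !qbinom_nat !addnS !addSn !(qpochS _ (a + b).+1).
rewrite (qpochS _ a) (qpochS _ b) -!exprS.
have -> : q ^+ (a + b).+2 = q ^+ a.+1 * q ^+ b.+1 by rewrite -exprD addnS.
have := subr_expq_neq0 a; have := subr_expq_neq0 b.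
move: (q ^+ a.+1) (q ^+ b.+1) => x y nz_y nz_x.
by field; rewrite !qpoch_neq0 nz_x nz_y.
Qed.

Lemma qbinom_pascal n m :
  qbinom q n.+1%:Z m
  = qbinom q n%:Z m + q ^ (n.+1%:Z - m) * qbinom q n%:Z (m - 1).
Proof.
have [m_in|m_out] := boolP (0 <= m <= n.+1%:Z); last first.
  by rewrite !qbinom_out ?mulr0 ?addr0 //; lia.
have [->|m_neq0] := eqVneq m 0.
  by rewrite !qbinom0 (@qbinom_out _ (0 - 1)) // mulr0 addr0.
have [->|m_neqn] := eqVneq m n.+1%:Z.
  rewrite subrr expr0z mul1r (@qbinom_out n) ?add0r; last by lia.
  by rewrite qbinom_diag -[n.+1]addn1 PoszD addrK qbinom_diag.
have [a [b [-> ->]]] : exists a b : nat, m = a.+1%:Z /\ n = (a + b).+1.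
  by exists `|m - 1|%N, `|n%:Z - m|%N; lia.
have -> : (a + b).+2%:Z - a.+1%:Z = b.+1%:Z by lia.
have -> : a.+1%:Z - 1 = a%:Z by lia.
by have := qbinom_pascal_nat a b; rewrite !addSn !addnS.
Qed.

Lemma qbinom_pascal_central n (j : int) :
  q ^ (j * (j + 1)) * qbinom q (2 * n%:Z + 1) (n%:Z - j)
  = q ^ (j * (j + 1)) * qbinom q (2 * n%:Z) (n%:Z - j)
    + q ^+ n * (q ^ ((j + 1) * (j + 1))
                * qbinom q (2 * n%:Z) (n%:Z - (j + 1))).
Proof.
have -> : 2 * n%:Z + 1 = (2 * n).+1%:Z by lia.
rewrite qbinom_pascal mulrDr; congr (_ + _).
have [j_small|j_ge] := ltP j (- n%:Z - 1).
  by rewrite !qbinom_out ?mulr0 //; lia.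
rewrite exprnP !mulrA -!exprzD_ss; [|nia|nia].
by congr (q ^ _ * qbinom _ _ _); lia.
Qed.

End QBinomial.

Theorem theorem11 (F : fieldType) (q : F)
    (hq : forall k : nat, (0 < k)%N -> q ^+ k <> 1) (L : nat) :
  \sum_(j <- zrange (- L%:Z) L%:Z)
     (jacobi3 (j + 1))%:~R * q ^ (j * (j + 1)) * qbinom q (2 * L%:Z) (L%:Z - j)
  = \sum_(j <- zrange (- L%:Z - 1) (L%:Z + 1))
     (jacobi3 (j + 1))%:~R * q ^ (j * (j + 1))
       * qbinom q (2 * L%:Z + 1) (L%:Z - j).
Proof.
pose w k := q ^ (k * k) * qbinom q (2 * L%:Z) (L%:Z - k).
have w_even k : w (- k) = w k.
  by rewrite /w mulrNN -qbinom_sub; congr (_ * qbinom _ _ _); lia.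
have w_out k : ~~ (- L%:Z <= k <= L%:Z) -> w k = 0.
  by move=> k_out; rewrite /w qbinom_out ?mulr0 //; lia.
have sum_w0 : \sum_(j <- zrange (- L%:Z - 1) (L%:Z + 1))
                 (jacobi3 (j + 1))%:~R * w (j + 1) = 0.
  rewrite (sum_zrange_shift _ _ _ (fun k => (jacobi3 k)%:~R * w k)).
  rewrite (@sum_zrange_widen _ (- L%:Z) L%:Z) ?sum_jacobi3_even //; [lia|lia|].
  by move=> k /w_out ->; rewrite mulr0.
under [RHS]eq_bigr do
  rewrite -mulrA (qbinom_pascal_central hq) -/(w _) mulrDr mulrA mulrCA.
rewrite big_split /= -mulr_sumr sum_w0 mulr0 addr0; symmetry.
by apply: sum_zrange_widen => [||j j_out]; rewrite ?qbinom_out ?mulr0 //; lia.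
Qed.
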